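(* Let $A$ be a C*-factor of von Neumann type I. Then there exists a cardinal number $n$ such that $A$ is a C*-algebra of type $I_n$.
   Context: A C*-algebra $A$ is a C*-factor if it does not have nonzero proper two-sided ideals $I,J$ with $IJ=\{ab:a\in I,b\in J\}=\{0\}$. For $S\subseteq A$, $\mathrm{Ann}(S)=\{a\in A: as+sa=0 \text{ for all } s\in S\}$; the set of annihilators is $\mathcal{P}=\{\mathrm{Ann}(\mathrm{Ann}(S)): S\subseteq A_+\}$, ordered by inclusion (a complete lattice; suprema are taken in $\mathcal{P}$). For $V\subseteq A$ let ${}^dV=\{a\in A: xay+yax=0 \ \forall x,y\in V\}$. $V\in\mathcal{P}$ is central if ${}^d(\mathrm{Ann}(\mathrm{Ann}(S)))\cap{}^d(\mathrm{Ann}(S))=\{0\}$ where $S\subseteq A_+$, $V=\mathrm{Ann}(\mathrm{Ann}(S))$. The central support $c(V)$ of $V\in\mathcal{P}$ is the greatest lower bound in $\mathcal{P}$ of the central annihilators containing $V$. $V\in\mathcal{P}$ is Abelian if it is commutative. $A$ is of von Neumann type I if there is an Abelian annihilator $V$ with $c(V)=A$. Annihilators $V,W$ are orthogonal if $\{vw:v\in V,w\in W\}=\{0\}$. For a cardinal $n$, $A$ is a C*-algebra of type $I_n$ if there is a family $\{P_i\}_{i\in\Xi}$ with $|\Xi|=n$ of pairwise orthogonal Abelian annihilators with central support $A$ and with $\sup_i P_i=A$ in $\mathcal{P}$. *)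

(* Defs.v *)
From HB Require Import structures.
From mathcomp Require Import all_boot all_order all_algebra.
From mathcomp Require Import complex reals.
Set Implicit Arguments. Unset Strict Implicit. Unset Printing Implicit Defensive.
Import Order.TTheory GRing.Theory Num.Theory.
Local Open Scope ring_scope.

Definition modc (R : realType) (c : R[i]) : R :=
  Num.sqrt (complex.Re c ^+ 2 + complex.Im c ^+ 2).

Record is_cstar_algebra (R : realType) (A : lmodType R[i])
    (mul : A -> A -> A) (star : A -> A) (nrm : A -> R) : Prop := {
  mulA : forall x y z, mul x (mul y z) = mul (mul x y) z;
  mul_linl : forall (a : R[i]) x y z, mul (a *: x + y) z = a *: mul x z + mul y z;
  mul_linr : forall (a : R[i]) x y z, mul z (a *: x + y) = a *: mul z x + mul z y;
  star_antilin : forall (a : R[i]) x y,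
      star (a *: x + y) = (conjc a) *: star x + star y;
  starK : forall x, star (star x) = x;
  star_mul : forall x y, star (mul x y) = mul (star y) (star x);
  nrm_ge0 : forall x, 0 <= nrm x;
  nrm_eq0 : forall x, nrm x = 0 -> x = 0;
  nrm_triangle : forall x y, nrm (x + y) <= nrm x + nrm y;
  nrm_scale : forall (a : R[i]) x, nrm (a *: x) = modc a * nrm x;
  nrm_submul : forall x y, nrm (mul x y) <= nrm x * nrm y;
  nrm_cstar : forall x, nrm (mul (star x) x) = nrm x ^+ 2;
  complete : forall u : nat -> A,
      (forall e : R, 0 < e -> exists N, forall m n, (N <= m)%N -> (N <= n)%N ->
          nrm (u m - u n) < e) ->
      exists l : A, forall e : R, 0 < e -> exists N, forall n, (N <= n)%N ->
          nrm (u n - l) < e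
}.

Section CStarNotions.
Variables (R : realType) (A : lmodType R[i]) (mul : A -> A -> A) (star : A -> A).

Definition two_sided_ideal (I : A -> Prop) : Prop :=
  I 0 /\ (forall x y, I x -> I y -> I (x + y)) /\
  (forall (a : R[i]) x, I x -> I (a *: x)) /\
  (forall x y, I x -> I (mul y x) /\ I (mul x y)).

Definition cstar_factor : Prop :=
  ~ exists I J : A -> Prop,
      two_sided_ideal I /\ two_sided_ideal J /\
      (exists x, I x /\ x <> 0) /\ (exists x, J x /\ x <> 0) /\
      (exists x, ~ I x) /\ (exists x, ~ J x) /\
      (forall a b, I a -> J b -> mul a b = 0).

Definition positive (a : A) : Prop := exists b, a = mul (star b) b.

Definition Ann (S : A -> Prop) : A -> Prop :=
  fun a => forall s, S s -> mul a s + mul s a = 0.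

Definition annihilator (V : A -> Prop) : Prop :=
  exists S : A -> Prop, (forall s, S s -> positive s) /\
    (forall a, V a <-> Ann (Ann S) a).

Definition dperp (V : A -> Prop) : A -> Prop :=
  fun a => forall x y, V x -> V y -> mul (mul x a) y + mul (mul y a) x = 0.

Definition central (V : A -> Prop) : Prop :=
  exists S : A -> Prop, (forall s, S s -> positive s) /\
    (forall a, V a <-> Ann (Ann S) a) /\
    (forall a, dperp (Ann (Ann S)) a -> dperp (Ann S) a -> a = 0).

Definition subsetA (V W : A -> Prop) : Prop := forall a, V a -> W a.

Definition is_central_support (V W : A -> Prop) : Prop :=
  annihilator W /\
  (forall C, central C -> subsetA V C -> subsetA W C) /\
  (forall U, annihilator U ->
     (forall C, central C -> subsetA V C -> subsetA U C) -> subsetA U W).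

Definition full_central_support (V : A -> Prop) : Prop :=
  is_central_support V (fun _ => True).

Definition abelian (V : A -> Prop) : Prop :=
  forall x y, V x -> V y -> mul x y = mul y x.

Definition vN_type_I : Prop :=
  exists V, annihilator V /\ abelian V /\ full_central_support V.

Definition orthogonal (V W : A -> Prop) : Prop :=
  forall v w, V v -> W w -> mul v w = 0.

Definition is_sup_in_P (Xi : Type) (F : Xi -> A -> Prop) (W : A -> Prop) : Prop :=
  annihilator W /\ (forall i, subsetA (F i) W) /\
  (forall U, annihilator U -> (forall i, subsetA (F i) U) -> subsetA W U).

(* type I_n, where the cardinal n is the cardinality of the index type Xi *)
Definition type_I_n (Xi : Type) : Prop :=
  exists F : Xi -> A -> Prop,
    (forall i, annihilator (F i) /\ abelian (F i) /\ full_central_support (F i)) /\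
    (forall i j, i <> j -> orthogonal (F i) (F j)) /\
    is_sup_in_P F (fun _ => True).

End CStarNotions.

(* Main.v *)
(* In a C*-factor every central annihilator is a two-sided ideal, hence 0 or A, so
   an annihilator has full central support as soon as it is nonzero. Zorn's lemma
   gives a maximal set E of pairwise orthogonal positive elements h <> 0 with {h}''
   abelian. If the supremum of the {h}'' were not A, then W = E' would be nonzero;
   for an abelian annihilator V <> 0 the factor property gives x in W A V nonzero,
   and {x x^*}'' is abelian because {x^* x}'' lies in V, contradicting maximality.
   All this is algebra once Ann S is known to be the two-sided annihilator of S,
   that is, a s = - s a with s = b^* b implies a s = 0; this needs s >= 0 in the
   spectral sense (Kaplansky), which is proved here by square roots obtained from
   a convergent iteration. *)
Require Import Defs.
From HB Require Import structures.
From mathcomp Require Import all_boot all_order all_algebra.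
From mathcomp Require Import complex reals.
From mathcomp Require Import boolp classical_sets ring lra.
Set Implicit Arguments. Unset Strict Implicit. Unset Printing Implicit Defensive.
Import Order.TTheory GRing.Theory Num.Theory.
Local Open Scope ring_scope.

(** * Square-zero extensions for deciding linear identities *)

(* The square-zero extension K (+) V is a commutative ring, so that the ring
   tactic run in it decides linear identities in V. *)
Section SquareZero.
Variables (K : fieldType) (V : lmodType K).

Definition sqzero : Type := (K * V)%type.
HB.instance Definition _ := GRing.Zmodule.on sqzero.

Definition sqzero_one : sqzero := (1, 0).
Definition sqzero_mul (u v : sqzero) : sqzero :=
  (u.1 * v.1, u.1 *: v.2 + v.1 *: u.2).

Fact sqzero_mulA : associative sqzero_mul.
Proof.
move=> [a x] [b y] [c z]; rewrite /sqzero_mul /= mulrA; congr pair.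
by rewrite !scalerDr !scalerA addrA [c * a]mulrC [c * b]mulrC.
Qed.
Fact sqzero_mulC : commutative sqzero_mul.
Proof. by move=> [a x] [b y]; rewrite /sqzero_mul /= mulrC addrC. Qed.
Fact sqzero_mul1 : left_id sqzero_one sqzero_mul.
Proof. by move=> [a x]; rewrite /sqzero_mul /= mul1r scale1r scaler0 addr0. Qed.
Fact sqzero_mulDl : left_distributive sqzero_mul +%R.
Proof.
move=> [a x] [b y] [c z]; rewrite /sqzero_mul /=; congr pair; first exact: mulrDl.
by rewrite /= scalerDl scalerDr addrACA.
Qed.
Fact sqzero_one_neq0 : sqzero_one != 0.
Proof. by apply/eqP => -[] /eqP; rewrite oner_eq0. Qed.

HB.instance Definition _ := GRing.Zmodule_isComNzRing.Build sqzero
  sqzero_mulA sqzero_mulC sqzero_mul1 sqzero_mulDl sqzero_one_neq0.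

Definition sqz (x : V) : sqzero := (0, x).
Definition sqk (a : K) : sqzero := (a, 0).

Lemma sqzD x y : sqz (x + y) = sqz x + sqz y.
Proof. by congr pair; rewrite /= addr0. Qed.
Lemma sqzN x : sqz (- x) = - sqz x.
Proof. by congr pair; rewrite /= oppr0. Qed.
Lemma sqz0 : sqz 0 = 0. Proof. by []. Qed.
Lemma sqzZ a x : sqz (a *: x) = sqk a * sqz x.
Proof. by congr pair; rewrite /= ?mulr0 // scale0r addr0. Qed.
Lemma sqz_inj : injective sqz. Proof. by move=> x y []. Qed.

Fact sqk_zmod_morphism : zmod_morphism sqk.
Proof. by move=> a b; congr pair; rewrite /= subr0. Qed.
Fact sqk_monoid_morphism : monoid_morphism sqk.
Proof. by split=> // a b; congr pair; rewrite /= !scaler0 addr0. Qed.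
HB.instance Definition _ :=
  GRing.isZmodMorphism.Build K sqzero sqk sqk_zmod_morphism.
HB.instance Definition _ :=
  GRing.isMonoidMorphism.Build K sqzero sqk sqk_monoid_morphism.
End SquareZero.


Ltac module := apply: sqz_inj; rewrite ?(sqzD, sqzN, sqzZ, sqz0); ring.

(** An Archimedean substitute for passing to the limit: the convergence below comes with explicit
    rates c / (n + 1). *)
Lemma le_of_le_harmonic (R : realType) (u v c : R) :
  (forall n : nat, u <= v + c / n.+1%:R) -> u <= v.
Proof.
move=> h; rewrite leNgt; apply/negP => vu.
have d0 : 0 < u - v by rewrite subr_gt0.
have c0 : 0 <= c by have := h 0%N; rewrite invr1 mulr1; lra.
have hn : c / (u - v) < (Num.bound (c / (u - v)))%:R.
  by apply: archi_boundP; rewrite divr_ge0 // ltW.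
set n := Num.bound _ in hn.
have n0 : (0 : R) < n.+1%:R by rewrite ltr0n.
have hc : u - v <= c / n.+1%:R by rewrite lerBlDl.
move: hn hc; rewrite ltr_pdivrMr // ler_pdivlMr // -natr1; nra.
Qed.

(** * The scalar majorant iteration *)

Section QuarterIteration.
Variable R : realType.

(* t_n increases to 1/2; it dominates the iteration w |-> z + w^2 for every z with
   |z| <= 1/4, whose limit w satisfies (1 - 2w)^2 = 1 - 4z. *)
Fixpoint quarter_iter (n : nat) : R :=
  if n is m.+1 then 4%:R^-1 + quarter_iter m ^+ 2 else 0.
Local Notation t := quarter_iter.

Lemma quarter_iter_bounds n : 0 <= t n <= 2^-1.
Proof. by elim: n => [|n /andP[h1 h2]] /=; apply/andP; split; nra. Qed.

Lemma quarter_iter_nondecr n m : (n <= m)%N -> t n <= t m.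
Proof.
move=> /subnK <-; elim: (m - n)%N => [//|k ih]; apply: le_trans ih _.
by rewrite addSn /=; have := sqr_ge0 (t (k + n) - 2^-1); nra.
Qed.

(** With g = 1/2 - t_n the next gap is g (1 - g), and this recursion decays harmonically. *)
Lemma quarter_iter_rate n : 2^-1 - t n <= n.+1%:R^-1.
Proof.
elim: n => [|n ih] /=; first by rewrite invr1; lra.
have /andP[t0 t1] := quarter_iter_bounds n.
have n0 : (0 : R) < n.+1%:R by rewrite ltr0n.
have step (s N : R) : 0 <= s -> 0 < N -> 2^-1 - s <= N^-1 ->
    2^-1 - (4^-1 + s ^+ 2) <= (N + 1)^-1.
  move=> s0 N0; rewrite -[X in _ <= X -> _]mul1r ler_pdivlMr // => h.
  rewrite -[X in _ <= X]mul1r ler_pdivlMr ?addr_gt0 //.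
  (* This product gives (1/4 - s^2) N <= 1/2 + s, hence (1/4 - s^2) (N + 1) <= 1 - (1/2 - s)^2 <=
     1. *)
  have h1 : 0 <= (2^-1 + s) * (1 - (2^-1 - s) * N).
    by rewrite mulr_ge0 ?subr_ge0 // addr_ge0 // invr_ge0.
  by have h2 := sqr_ge0 (2^-1 - s); lra.
by rewrite -[n.+2%:R]natr1; exact: step.
Qed.
End QuarterIteration.

(** * Elementary calculus in a C*-algebra *)

Section CStarAlgebra.
Variables (R : realType) (A : lmodType R[i]).
Variables (mul : A -> A -> A) (star : A -> A) (nrm : A -> R).
Hypothesis HA : is_cstar_algebra mul star nrm.
Local Open Scope complex_scope.
Local Notation "x ** y" := (mul x y) (at level 40, left associativity).
Local Notation t := (@quarter_iter R).

Let mulA x y z : x ** (y ** z) = x ** y ** z.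
Proof. exact: (Defs.mulA HA). Qed.

Lemma mulDl x y z : (x + y) ** z = x ** z + y ** z.
Proof. by have := mul_linl HA 1 x y z; rewrite !scale1r. Qed.
Lemma mulDr x y z : z ** (x + y) = z ** x + z ** y.
Proof. by have := mul_linr HA 1 x y z; rewrite !scale1r. Qed.
Lemma mul0x x : 0 ** x = 0.
Proof. by apply: (addrI (0 ** x)); rewrite -mulDl !addr0. Qed.
Lemma mulx0 x : x ** 0 = 0.
Proof. by apply: (addrI (x ** 0)); rewrite -mulDr !addr0. Qed.
Lemma mulZl a x z : (a *: x) ** z = a *: (x ** z).
Proof. by have := mul_linl HA a x 0 z; rewrite mul0x !addr0. Qed.
Lemma mulZr a x z : z ** (a *: x) = a *: (z ** x).
Proof. by have := mul_linr HA a x 0 z; rewrite mulx0 !addr0. Qed.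
Lemma mulNl x z : (- x) ** z = - (x ** z).
Proof. by rewrite -scaleN1r mulZl scaleN1r. Qed.
Lemma mulNr x z : z ** (- x) = - (z ** x).
Proof. by rewrite -scaleN1r mulZr scaleN1r. Qed.
Let mulE := (mulDl, mulDr, mulNl, mulNr, mulZl, mulZr).

Lemma starD x y : star (x + y) = star x + star y.
Proof. by have := star_antilin HA 1 x y; rewrite conjc1 !scale1r. Qed.
Lemma star0 : star 0 = 0.
Proof. by apply: (addrI (star 0)); rewrite -starD !addr0. Qed.
Lemma starZ a x : star (a *: x) = conjc a *: star x.
Proof. by have := star_antilin HA a x 0; rewrite star0 !addr0. Qed.
Lemma starN x : star (- x) = - star x.
Proof. by apply: (addrI (star x)); rewrite -starD !subrr star0. Qed.
Let starM x y : star (x ** y) = star y ** star x.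
Proof. exact: (star_mul HA). Qed.
Let starK x : star (star x) = x.
Proof. exact: (Defs.starK HA). Qed.
Let starE := (starD, starN, starZ, starM, starK).

Lemma nrm_real (r : R) x : nrm (r%:C *: x) = `|r| * nrm x.
Proof. by rewrite (nrm_scale HA) /modc /= expr0n addr0 sqrtr_sqr. Qed.
Lemma nrmN x : nrm (- x) = nrm x.
Proof.
by have := nrm_real (-1) x; rewrite rmorphN rmorph1 scaleN1r normrN1 mul1r.
Qed.
Lemma nrm0 : nrm 0 = 0.
Proof. by have := nrm_real 0 0; rewrite scaler0 normr0 mul0r. Qed.
Let nrm_ge0 x : 0 <= nrm x. Proof. exact: (Defs.nrm_ge0 HA). Qed.
Lemma nrmB x y : nrm (x - y) <= nrm x + nrm y.
Proof. by rewrite -(nrmN y); exact: (nrm_triangle HA). Qed.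
Lemma nrm_distC x y : nrm (x - y) = nrm (y - x).
Proof. by rewrite -nrmN opprB. Qed.
Lemma nrm_star x : nrm (star x) = nrm x.
Proof.
suff h y : nrm y <= nrm (star y) by apply/eqP; rewrite eq_le -{2}[x]starK !h.
have := nrm_submul HA (star y) y; rewrite (nrm_cstar HA).
have := nrm_ge0 y; have := nrm_ge0 (star y); nra.
Qed.
Lemma nrm_sqr_sa h : star h = h -> nrm (h ** h) = nrm h ^+ 2.
Proof. by move=> hh; rewrite -(nrm_cstar HA) hh. Qed.
Lemma star_mul_eq0 x : star x ** x = 0 -> x = 0.
Proof.
move=> h; apply: (nrm_eq0 HA); apply/eqP.
by rewrite -sqrf_eq0 -(nrm_cstar HA) h nrm0.
Qed.
Lemma mul_star_eq0 x : x ** star x = 0 -> x = 0.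
Proof.
by rewrite -{1}[x]starK => /star_mul_eq0 h; rewrite -[x]starK h star0.
Qed.

(** Testing on x = a^* gives |a|^2 <= c |a|. Since no unit is assumed, estimates are made on left
    multiplications and brought back to A here. *)
Lemma nrm_le_op a c : 0 <= c -> (forall x, nrm (a ** x) <= c * nrm x) ->
  nrm a <= c.
Proof.
move=> c0 /(_ (star a)); rewrite nrm_star.
have := nrm_cstar HA (star a); rewrite nrm_star starK => ->.
have := nrm_ge0 a; nra.
Qed.

Lemma complete_harmonic (u : nat -> A) (c : R) :
  (forall n m, (n <= m)%N -> nrm (u m - u n) <= c / n.+1%:R) ->
  exists l, forall n, nrm (u n - l) <= c / n.+1%:R.
Proof.
move=> h; have [|l hl] := complete HA (u := u).
  move=> e e0; have c0 : 0 <= c.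
    by have := h 0%N 0%N (leqnn _); rewrite invr1 mulr1; apply: le_trans.
  have hn : c / e < (Num.bound (c / e))%:R.
    by apply: archi_boundP; rewrite divr_ge0 // ltW.
  exists (Num.bound (c / e)); set N := Num.bound _ in hn *.
  have small n : (N <= n)%N -> c / n.+1%:R < e.
    move=> Nn; rewrite ltr_pdivrMr ?ltr0n // mulrC -ltr_pdivrMr //.
    by apply: (lt_le_trans hn); rewrite ler_nat ltnW.
  move=> m n Nm Nn; case/orP: (leq_total m n) => mn.
    by rewrite nrm_distC; apply: le_lt_trans (h _ _ mn) (small _ Nm).
  exact: le_lt_trans (h _ _ mn) (small _ Nn).
exists l => n; apply/ler_addgt0Pr => e e0; have [N hN] := hl e e0.
have -> : u n - l = (u (maxn n N) - l) - (u (maxn n N) - u n) by module.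
apply: le_trans (nrmB _ _) _; rewrite addrC lerD ?h ?leq_maxl // ltW //.
by apply: hN; rewrite leq_maxr.
Qed.

(** * Convergence of the root iteration *)

(* With w = eps t_n - a_n and z = eps/4 - y this is the iteration w |-> z + w^2 of
   a formal unitization, kept inside A: for eps = 1 the limit is a square root
   of y, for eps = 0 it gives a square root 1 + 2 a of 1 + 4 y. *)
Section Iteration.
Variables (eps : R) (y : A).
Hypothesis eps01 : eps = 0 \/ eps = 1.
Hypothesis y_bound : forall x,
  nrm ((eps / 4%:R)%:C *: x - y ** x) <= 4%:R^-1 * nrm x.

Fixpoint root_iter (n : nat) : A :=
  if n is m.+1 then
    y + (eps * t m *+ 2)%:C *: root_iter m - root_iter m ** root_iter m
  else 0.
Local Notation a := root_iter.

Let W n x := (eps * t n)%:C *: x - a n ** x.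

(** This is w_{n+1} = z + w_n^2 for left multiplications. It uses eps^2 = eps, whence the
    restriction of eps to 0 and 1. *)
Let W_rec n x :
  W n.+1 x = ((eps / 4%:R)%:C *: x - y ** x) + W n (W n x).
Proof.
have eps2 : eps * eps = eps by case: eps01 => ->; ring.
have E : (eps * t n.+1)%:C *: x =
    (eps / 4%:R)%:C *: x + ((eps * t n) * (eps * t n))%:C *: x.
  rewrite -scalerDl -rmorphD /=; congr (_%:C *: _).
  by rewrite mulrACA eps2 expr2 mulrDr.
rewrite {1}/W {}E /W [a n.+1]/= !mulE mulA; module.
Qed.

Let W_sub n x z : W n (x - z) = W n x - W n z.
Proof. by rewrite /W !mulE; module. Qed.

Lemma root_iter_bound n x :
  nrm ((eps * t n)%:C *: x - a n ** x) <= t n * nrm x.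
Proof.
rewrite -/(W n x); elim: n x => [|n ih] x.
  by rewrite /W /= mulr0 mul0x subr0 scale0r nrm0 mul0r.
rewrite W_rec; apply: le_trans (nrm_triangle HA _ _) _.
rewrite /= mulrDl lerD ?y_bound // expr2 -mulrA.
apply: le_trans (ih _) _; apply: ler_wpM2l (ih x).
by case/andP: (quarter_iter_bounds R n).
Qed.

(** From w_{n+2} - w_{n+1} = w_{n+1} (w_{n+1} - w_n) + (w_{n+1} - w_n) w_n. The increments of t
    satisfy the same identity, so they majorize. *)
Let W_step n x : nrm (W n.+1 x - W n x) <= (t n.+1 - t n) * nrm x.
Proof.
elim: n x => [|n ih] x.
  rewrite W_rec {2 3}/W /= mulr0 mul0x scale0r subr0 !subr0 expr0n addr0.
  by rewrite /W /= mulr0 mul0x scale0r subrr addr0 y_bound.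
have -> : W n.+2 x - W n.+1 x =
    W n.+1 (W n.+1 x - W n x) + (W n.+1 (W n x) - W n (W n x)).
  rewrite W_sub [W n.+2 x]W_rec; set u := W n.+1 (W n.+1 x).
  by set v := W n.+1 (W n x); rewrite W_rec; module.
have /andP[tn0 _] := quarter_iter_bounds R n.
have /andP[tn1 _] := quarter_iter_bounds R n.+1.
have d0 : 0 <= t n.+1 - t n by rewrite subr_ge0 quarter_iter_nondecr.
apply: le_trans (nrm_triangle HA _ _) _.
have -> : (t n.+2 - t n.+1) * nrm x =
    t n.+1 * ((t n.+1 - t n) * nrm x) + (t n.+1 - t n) * (t n * nrm x).
  by rewrite /=; ring.
apply: lerD.
  apply: le_trans (root_iter_bound n.+1 _) _; exact: ler_wpM2l (ih x).
apply: le_trans (ih _) _; apply: ler_wpM2l => //; exact: root_iter_bound.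
Qed.

Lemma root_iter_rate n m : (n <= m)%N -> nrm (a m - a n) <= 2%:R / n.+1%:R.
Proof.
move=> nm; have tt := quarter_iter_nondecr R nm.
have Wnm x : nrm (W m x - W n x) <= (t m - t n) * nrm x.
  rewrite -(subnK nm); elim: (m - n)%N => [|k ih].
    by rewrite !subrr nrm0 mul0r.
  rewrite addSn; have -> : W (k + n).+1 x - W n x =
    (W (k + n).+1 x - W (k + n)%N x) + (W (k + n)%N x - W n x) by module.
  apply: le_trans (nrm_triangle HA _ _) _.
  by apply: le_trans (lerD (W_step _ _) ih) _; rewrite -mulrDl addrA subrK.
have td : t m - t n <= n.+1%:R^-1.
  apply: le_trans (quarter_iter_rate R n); rewrite lerD2r.
  by case/andP: (quarter_iter_bounds R m).
(* The factor 2 counts the scalar part eps (t_m - t_n) and the increment of [W], each bounded by t_m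
   - t_n. *)
apply: le_trans (_ : (t m - t n) *+ 2 <= _);
  last by move: (_%:R^-1) td => d td; lra.
apply: nrm_le_op; first by rewrite mulrn_wge0 ?subr_ge0.
move=> x; have -> : (a m - a n) ** x =
    (eps * (t m - t n))%:C *: x - (W m x - W n x).
  by rewrite /W !mulE; module.
apply: le_trans (nrmB _ _) _; rewrite nrm_real mulr2n mulrDl lerD //.
rewrite ler_wpM2r // ger0_norm; case: eps01 => ->;
  by rewrite ?mul0r ?mul1r ?subr_ge0.
Qed.

Lemma root_iter_comm z n : z ** y = y ** z -> z ** a n = a n ** z.
Proof.
move=> zy; elim: n => [|n ih] /=; first by rewrite mulx0 mul0x.
by rewrite !mulE zy ih mulA ih -mulA ih mulA.
Qed.

Lemma root_iter_sa n : star y = y -> star (a n) = a n.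
Proof.
move=> yy; elim: n => [|n ih] /=; first exact: star0.
by rewrite !starE yy ih conjc_real.
Qed.

(** As t_n tends to 1/2, the limit w = eps/2 - b satisfies w = z + w^2 and |w| <= 1/2; in terms of b
    these are the last two clauses. *)
Lemma root_iter_limit : star y = y -> exists b,
  [/\ star b = b, forall z, z ** y = y ** z -> z ** b = b ** z,
      b = y + eps%:C *: b - b ** b &
      forall x, nrm ((eps / 2%:R)%:C *: x - b ** x) <= 2^-1 * nrm x].
Proof.
move=> yy; have [b hb] := complete_harmonic root_iter_rate.
have eps0 : 0 <= eps by case: eps01 => ->.
have eps1 : eps <= 1 by case: eps01 => ->.
have eq0 c x : (forall n : nat, nrm x <= c / n.+1%:R) -> x = 0.
  move=> h; apply: (nrm_eq0 HA); apply/eqP; rewrite eq_le nrm_ge0 andbT.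
  by apply: (@le_of_le_harmonic _ _ _ c) => n; rewrite add0r.
exists b; split.
- apply/eqP; rewrite -subr_eq0; apply/eqP; apply: (eq0 4%:R) => n.
  have -> : star b - b = (a n - b) - star (a n - b).
    by rewrite !starE root_iter_sa //; module.
  apply: le_trans (nrmB _ _) _; rewrite nrm_star.
  by have := hb n; move: (_%:R^-1) => d h; lra.
- move=> z zy; apply/eqP; rewrite -subr_eq0; apply/eqP.
  apply: (eq0 (4%:R * nrm z)) => n.
  have -> : z ** b - b ** z = (a n - b) ** z - z ** (a n - b).
    by rewrite !mulE root_iter_comm //; module.
  apply: le_trans (nrmB _ _) _.
  have := nrm_submul HA (a n - b) z; have := nrm_submul HA z (a n - b).
  have := ler_wpM2l (nrm_ge0 z) (hb n).
  by move: (n.+1%:R^-1) => d h1 h2 h3; lra.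
- have an n : nrm (a n) <= 1.
    have /andP[t0 t1] := quarter_iter_bounds R n.
    apply: nrm_le_op => // x; have h := root_iter_bound n x.
    have -> : a n ** x = (eps * t n)%:C *: x - ((eps * t n)%:C *: x - a n ** x).
      by module.
    have := nrmB ((eps * t n)%:C *: x) ((eps * t n)%:C *: x - a n ** x).
    rewrite nrm_real ger0_norm ?mulr_ge0 //.
    have : eps * t n * nrm x <= 2^-1 * nrm x.
      by rewrite ler_wpM2r //; nra.
    have := ler_wpM2r (nrm_ge0 x) t1; lra.
  (* The five error terms below are bounded by 2d, 2d, 4d, 2d and 2d. *)
  apply/eqP; rewrite -subr_eq0; apply/eqP; apply: (eq0 12%:R) => n.
  set d := n.+1%:R^-1.
  have ba : nrm (b - a n) <= 2%:R * d by rewrite nrm_distC hb.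
  have bd : nrm (b - a n.+1) <= 2%:R * d.
    rewrite nrm_distC; apply: le_trans (hb _) _; rewrite ler_wpM2l //.
    by rewrite lef_pV2 ?posrE ?ltr0n // ler_nat.
  have b2 : nrm b <= 2%:R by have := hb 0%N; rewrite /= sub0r nrmN divr1.
  have -> : b - (y + eps%:C *: b - b ** b) =
      (b - a n.+1) - eps%:C *: (b - a n) + ((b - a n) ** b + a n ** (b - a n))
      - (eps * (1 - t n *+ 2))%:C *: a n.
    by rewrite [a n.+1]/= !mulE; module.
  have d0 : 0 <= d by rewrite invr_ge0.
  have /andP[t0 t1] := quarter_iter_bounds R n.
  have te := quarter_iter_rate R n; rewrite -/d in te; clearbody d.
  have p1 := nrm_submul HA (b - a n) b.
  have p2 := nrm_submul HA (a n) (b - a n).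
  have p3 : nrm (eps%:C *: (b - a n)) <= 2%:R * d.
    by rewrite nrm_real ger0_norm //; have := nrm_ge0 (b - a n); nra.
  have p4 : nrm ((eps * (1 - t n *+ 2))%:C *: a n) <= 2%:R * d.
    have s0 : 0 <= 1 - t n *+ 2 by lra.
    rewrite nrm_real ger0_norm ?mulr_ge0 //.
    apply: (@le_trans _ _ (1 * (2%:R * d) * 1)); last by rewrite mul1r mulr1.
    by rewrite !ler_pM ?mulr_ge0 //; lra.
  have q1 : nrm (b - a n) * nrm b <= (2%:R * d) * 2%:R by rewrite ler_pM.
  have q2 : nrm (a n) * nrm (b - a n) <= 1 * (2%:R * d) by rewrite ler_pM.
  have n1 := nrmB (b - a n.+1) (eps%:C *: (b - a n)).
  have n2 := nrm_triangle HA ((b - a n) ** b) (a n ** (b - a n)).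
  have n3 := nrm_triangle HA ((b - a n.+1) - eps%:C *: (b - a n))
    ((b - a n) ** b + a n ** (b - a n)).
  apply: le_trans (nrmB _ _) _; lra.
- move=> x; apply: (@le_of_le_harmonic _ _ _ (3%:R * nrm x)) => n.
  have -> : (eps / 2%:R)%:C *: x - b ** x =
    (eps * (2^-1 - t n))%:C *: x + ((eps * t n)%:C *: x - a n ** x)
    + (a n - b) ** x by rewrite !mulE; module.
  have /andP[t0 t1] := quarter_iter_bounds R n.
  have te := quarter_iter_rate R n.
  have s0 : 0 <= 2^-1 - t n by rewrite subr_ge0.
  have p1 : nrm ((eps * (2^-1 - t n))%:C *: x) <= n.+1%:R^-1 * nrm x.
    rewrite nrm_real ger0_norm ?mulr_ge0 // ler_wpM2r //.
    by apply: le_trans te; rewrite ler_piMl.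
  have p2 := root_iter_bound n x.
  have p3 := nrm_submul HA (a n - b) x.
  have p4 := ler_wpM2r (nrm_ge0 x) (hb n).
  have p5 := ler_wpM2r (nrm_ge0 x) t1.
  have n1 := nrm_triangle HA ((eps * (2^-1 - t n))%:C *: x)
    ((eps * t n)%:C *: x - a n ** x).
  apply: le_trans (nrm_triangle HA _ _) _.
  by move: (n.+1%:R^-1) p1 p4 {te} => d p1 p4; lra.
Qed.
End Iteration.

(** * Nonnegative spectrum, square roots and Kaplansky's argument *)

Let scaleRA (a b : R) (x : A) : a%:C *: (b%:C *: x) = (a * b)%:C *: x.
Proof. by rewrite scalerA -rmorphM. Qed.
Let scaleR1 (x : A) : 1%:C *: x = x.
Proof. exact: scale1r. Qed.

(* For self-adjoint x, |1 - s x| <= 1 for some s > 0 says that x has nonnegative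
   spectrum; A having no unit, 1 - s x is replaced by the operator z - s x z. *)
Definition psd (x : A) : Prop :=
  star x = x /\
  exists2 s : R, 0 < s & forall z, nrm (z - s%:C *: (x ** z)) <= nrm z.

(** For y = (s/4) x the hypothesis reads |1/4 - y| <= 1/4, so the iteration with eps = 1 yields b
    with b^2 = y. Then r = c b with c^2 = 4/s, and |1/2 - b| <= 1/2 says that r is again [psd]. *)
Lemma psd_sqrt x : psd x -> exists r,
  [/\ psd r, r ** r = x & forall z, z ** x = x ** z -> z ** r = r ** z].
Proof.
case=> xx [s s0 hs]; pose y := (s / 4%:R)%:C *: x.
have yy : star y = y by rewrite /y starE conjc_real xx.
have hy z : nrm ((1 / 4%:R)%:C *: z - y ** z) <= 4%:R^-1 * nrm z.
  have -> : (1 / 4%:R)%:C *: z - y ** z =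
      (4%:R^-1)%:C *: (z - s%:C *: (x ** z)).
    rewrite /y !mulE scalerBr scaleRA; congr (_%:C *: _ - _%:C *: _).
      by rewrite mul1r.
    by rewrite mulrC.
  by rewrite nrm_real ger0_norm ?invr_ge0 // ler_wpM2l ?invr_ge0.
have [b [bb bc bE bn]] := root_iter_limit (or_intror erefl) hy yy.
have b2 : b ** b = y.
  have -> : b ** b = b - b + b ** b by module.
  by rewrite {1}bE scaleR1; module.
pose c := Num.sqrt (4%:R / s).
have c2 : c * c = 4%:R / s by rewrite -expr2 sqr_sqrtr // divr_ge0 // ltW.
have c0 : 0 < c by rewrite sqrtr_gt0 divr_gt0.
exists (c%:C *: b); split.
- split; first by rewrite starE conjc_real bb.
  exists (2%:R / c); first by rewrite divr_gt0.
  move=> z; rewrite mulE scaleRA divfK ?gt_eqF //.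
  have := bn z; have -> : (1 / 2)%:C *: z - b ** z =
      (2^-1)%:C *: (z - 2%:C *: (b ** z)).
    have e : 2^-1 * 2 = 1 :> R by field.
    by rewrite scalerBr scaleRA e scaleR1 mul1r.
  by rewrite nrm_real ger0_norm ?invr_ge0 // ler_pM2l // invr_gt0.
- have e : c * c * (s / 4%:R) = 1 by rewrite c2; field; rewrite gt_eqF.
  by rewrite !mulE b2 /y !scaleRA e scaleR1.
- move=> z zx; rewrite !mulE; congr (_ *: _).
  by apply: bc; rewrite /y !mulE zx.
Qed.

(** The iteration with eps = 0 and y = - k^2/4 gives v = 1 + 2b with v^2 = 1 - k^2. As v and k
    commute, v + i k and v - i k are isometric, so their mean v is a contraction, and so is v^2. *)
Lemma contraction_sub_sqr k z :
  star k = k -> nrm k <= 1 -> nrm (z - k ** k ** z) <= nrm z.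
Proof.
move=> kk k1; pose y := - ((4%:R^-1)%:C *: (k ** k)).
have yy : star y = y by rewrite /y !starE conjc_real !kk.
have hy x : nrm ((0 / 4%:R)%:C *: x - y ** x) <= 4%:R^-1 * nrm x.
  rewrite mul0r scale0r sub0r nrmN /y !mulE nrmN nrm_real.
  rewrite ger0_norm ?invr_ge0 // ler_wpM2l ?invr_ge0 //.
  apply: le_trans (nrm_submul HA _ _) _; rewrite ler_piMl //.
  by rewrite nrm_sqr_sa // expr_le1.
have [b [bb bc bE _]] := root_iter_limit (or_introl erefl) hy yy.
have kb : k ** b = b ** k by apply: bc; rewrite /y !mulE mulA.
have kkE : k ** k = - (4%:R%:C *: b) - 4%:R%:C *: (b ** b).
  have -> : 4%:R%:C *: b = 4%:R%:C *: (y - b ** b).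
    by congr (_ *: _); rewrite {1}bE scale0r addr0.
  have e : 4%:R * 4%:R^-1 = 1 :> R by field.
  rewrite /y !(scalerBr, scalerN) scaleRA e scaleR1.
  by module.
pose v x := x + 2%:R%:C *: (b ** x).
have unit_sum (j : R[i]) x : j ^+ 2 = -1 -> conjc j = - j ->
    nrm (v x + j *: (k ** x)) = nrm x.
  move=> j2 cj; apply/eqP; rewrite -(@eqrXn2 _ 2) //; apply/eqP.
  rewrite -!(nrm_cstar HA); congr nrm.
  rewrite /v !(starE, mulE) !conjc_real cj bb kk -!mulA.
  have -> : k ** (k ** x) = - (4%:R%:C *: (b ** x)) - 4%:R%:C *: (b ** (b ** x)).
    by rewrite mulA kkE !mulE -mulA.
  have -> : k ** (b ** x) = b ** (k ** x) by rewrite !mulA kb.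
  rewrite !mulE.
  apply: sqz_inj; rewrite ?(sqzD, sqzN, sqzZ, sqz0).
  have j2' : sqk A j * sqk A j = -1 by rewrite -rmorphM -expr2 j2 rmorphN1.
  ring: j2'.
have i2 : ('i : R[i]) ^+ 2 = -1 by rewrite sqr_i.
have ci : conjc ('i : R[i]) = - 'i.
  by apply/eqP; rewrite eq_complex /= oppr0 !eqxx.
have i2' : (- 'i : R[i]) ^+ 2 = -1 by rewrite sqrrN i2.
have ci' : conjc (- 'i : R[i]) = - - 'i.
  by apply/eqP; rewrite eq_complex /= !oppr0 !eqxx.
have vx x : nrm (v x) <= nrm x.
  have e : 2%:R%:C *: v x = (v x + 'i *: (k ** x)) + (v x + (- 'i) *: (k ** x)).
    by rewrite scaleNr; module.
  have : nrm (2%:R%:C *: v x) <= nrm x + nrm x.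
    rewrite e; apply: le_trans (nrm_triangle HA _ _) _.
    by rewrite (unit_sum _ _ i2 ci) (unit_sum _ _ i2' ci').
  have := nrm_real 2 (v x); rewrite ger0_norm // => -> h; lra.
have -> : z - k ** k ** z = v (v z).
  by rewrite /v kkE !mulE mulA; module.
exact: le_trans (vx _) (vx _).
Qed.

Lemma psd_sqr k : star k = k -> psd (k ** k).
Proof.
move=> kk; split; first by rewrite starM kk.
(* Adding 1 keeps the divisor positive when k = 0. *)
have c0 : 0 < nrm k + 1 by rewrite ltr_wpDl.
pose d := (nrm k + 1)^-1; have d0 : 0 < d by rewrite invr_gt0.
exists (d * d); first exact: mulr_gt0.
move=> z; rewrite (_ : _ *: _ = (d%:C *: k) ** (d%:C *: k) ** z); last first.
  by rewrite !mulE !scaleRA.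
apply: contraction_sub_sqr; first by rewrite starE conjc_real kk.
by rewrite nrm_real gtr0_norm // mulrC ler_pdivrMr // mul1r lerDl.
Qed.

Lemma psdD x y : psd x -> psd y -> psd (x + y).
Proof.
move=> [xx [s s0 hs]] [yy [r r0 hr]]; split; first by rewrite starD xx yy.
have sr : 0 < s + r by rewrite addr_gt0.
(* With this constant, 1 minus the multiple of x + y is a convex combination of the contractions 1 -
   s x and 1 - r y. *)
exists (s * r / (s + r)); first by rewrite divr_gt0 // mulr_gt0.
move=> z; pose c := r / (s + r); pose d := s / (s + r).
have c0 : 0 <= c by rewrite divr_ge0 // ltW.
have d0 : 0 <= d by rewrite divr_ge0 // ltW.
have cd : c + d = 1 by rewrite /c /d; field; rewrite gt_eqF.
have -> : z - (s * r / (s + r))%:C *: ((x + y) ** z) =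
    c%:C *: (z - s%:C *: (x ** z)) + d%:C *: (z - r%:C *: (y ** z)).
  have cs : c * s = s * r / (s + r) by rewrite /c; ring.
  have dr : d * r = s * r / (s + r) by rewrite /d; ring.
  rewrite !scalerBr !scaleRA cs dr mulE scalerDr.
  have {1}-> : z = c%:C *: z + d%:C *: z by rewrite -scalerDl -rmorphD cd scaleR1.
  module.
apply: le_trans (nrm_triangle HA _ _) _; rewrite !nrm_real !ger0_norm //.
have -> : nrm z = c * nrm z + d * nrm z by rewrite -mulrDl cd mul1r.
by rewrite lerD // ler_wpM2l.
Qed.

(** If x is nonzero, rescaling the roots of x and - x gives k with |k| = 1 such that 1 - k^2 and 1 +
    k^2 are both contractions. Then 4 k^2 = (1 + k^2)^2 - (1 - k^2)^2 has norm at most 2, against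
    |k^2| = 1. *)
Lemma psd_antisym x : psd x -> psd (- x) -> x = 0.
Proof.
move=> /psd_sqrt[r [[rr _] rx _]] /psd_sqrt[q [[qq _] qx _]].
have rq : nrm q = nrm r.
  apply/eqP; rewrite -(@eqrXn2 _ 2) // -!nrm_sqr_sa // rx qx.
  by rewrite nrmN.
have [r0|r0] := eqVneq (nrm r) 0.
  by rewrite -rx (nrm_eq0 HA r0) mul0x.
pose c := (nrm r)^-1; have c0 : 0 <= c by rewrite invr_ge0.
have cr : star (c%:C *: r) = c%:C *: r by rewrite starE conjc_real rr.
have cq : star (c%:C *: q) = c%:C *: q by rewrite starE conjc_real qq.
have nr : nrm (c%:C *: r) = 1 by rewrite nrm_real ger0_norm // mulVf.
have nq : nrm (c%:C *: q) = 1 by rewrite nrm_real ger0_norm // rq mulVf.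
set k := c%:C *: r in cr nr.
have kq : (c%:C *: q) ** (c%:C *: q) = - (k ** k).
  by rewrite /k !mulE qx rx !scalerN.
have h1 z : nrm (z - k ** k ** z) <= nrm z.
  by apply: contraction_sub_sqr; rewrite ?nr.
have h2 z : nrm (z + k ** k ** z) <= nrm z.
  have -> : z + k ** k ** z = z - (c%:C *: q) ** (c%:C *: q) ** z.
    by rewrite kq mulNl opprK.
  by apply: contraction_sub_sqr; rewrite ?nq.
have : nrm (k ** k) <= 2^-1.
  apply: nrm_le_op => [|z]; first by rewrite invr_ge0.
  have e : 4%:R%:C *: (k ** k ** z) =
      (z + k ** k ** z + k ** k ** (z + k ** k ** z))
      - (z - k ** k ** z - k ** k ** (z - k ** k ** z)).
    by rewrite !mulE; module.
  have := nrm_real 4%:R (k ** k ** z); rewrite ger0_norm // e => e'.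
  have := nrmB (z + k ** k ** z + k ** k ** (z + k ** k ** z))
    (z - k ** k ** z - k ** k ** (z - k ** k ** z)).
  rewrite e'; have := le_trans (h1 (z - k ** k ** z)) (h1 z).
  have := le_trans (h2 (z + k ** k ** z)) (h2 z); lra.
by rewrite nrm_sqr_sa // nr expr1n leNgt invf_lt1 ?ltr1n ?ltr0n.
Qed.

Lemma psdD_eq0 x y : psd x -> psd y -> x + y = 0 -> x = 0.
Proof.
move=> px py xy; apply: psd_antisym => //.
by rewrite -[- x]addr0 -xy addKr.
Qed.

Lemma psd_mul_starD d : psd (star d ** d + d ** star d).
Proof.
pose h := d + star d; pose k := 'i *: (d - star d).
have ci : conjc ('i : R[i]) = - 'i.
  by apply/eqP; rewrite eq_complex /= oppr0 !eqxx.
have hh : star h = h by rewrite /h !starE addrC.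
have kk : star k = k by rewrite /k !starE ci; module.
have [hk [s s0 hs]] := psdD (psd_sqr hh) (psd_sqr kk).
have e : h ** h + k ** k = 2%:R%:C *: (star d ** d + d ** star d).
  have i2 : sqk A ('i : R[i]) * sqk A 'i = -1.
    by rewrite -rmorphM -expr2 sqr_i rmorphN1.
  rewrite /h /k !mulE.
  apply: sqz_inj; rewrite ?(sqzD, sqzN, sqzZ, sqz0); ring: i2.
split; first by rewrite !starE.
exists (s * 2%:R); first by rewrite mulr_gt0.
by move=> z; have := hs z; rewrite e mulZl scaleRA.
Qed.

(* Kaplansky's argument: with n = |x| - x and c = b n one gets c^* c = - p^2 for
   a self-adjoint p, and then d = c p makes - (d^* d + d d^* ) a sum of squares,
   so that c = 0 and x = |x|. *)
Lemma commute_of_commute_sqr x z : positive mul star x ->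
  z ** (x ** x) = x ** x ** z -> z ** x = x ** z.
Proof.
move=> [b xE]; have xx : star x = x by rewrite xE !starE.
(* Here u is |x|, and its root r makes p = n r self-adjoint with p^2 = n u n. *)
have [u [pu u2 uc]] := psd_sqrt (psd_sqr xx).
have [uu _] := pu.
have [r [[rr _] r2 rc]] := psd_sqrt pu.
have xu : x ** u = u ** x by apply: uc; rewrite mulA.
have xr : x ** r = r ** x by exact: rc.
have ur : u ** r = r ** u by apply: rc.
pose n := u - x; pose c := b ** n; pose p := n ** r.
have nn : star n = n by rewrite /n !starE uu xx.
have nr : n ** r = r ** n by rewrite /n !mulE ur xr.
have nu : n ** u = u ** n by rewrite /n !mulE xu.
have pp : star p = p by rewrite /p starM nn rr nr.
have xn : x ** n = - (u ** n) by rewrite /n !mulE u2 xu; module.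
have cc : star c ** c = - (p ** p).
  have -> : star c ** c = n ** (x ** n) by rewrite /c starM nn xE !mulA.
  by rewrite xn mulNr /p -mulA (mulA r) -nr -!mulA r2 nu.
have p0 : p = 0.
  pose d := c ** p.
  have d1 : star d ** d = - (p ** p ** (p ** p)).
    have -> : star d ** d = p ** (star c ** c) ** p by rewrite /d starM pp !mulA.
    by rewrite cc !mulE !mulA.
  have d2 : d ** star d = - (c ** star c ** (c ** star c)).
    have -> : d ** star d = c ** (p ** p) ** star c by rewrite /d starM pp !mulA.
    have -> : p ** p = - (star c ** c) by rewrite cc opprK.
    by rewrite !mulE !mulA.
  have p2 : star (p ** p) = p ** p by rewrite starM pp.
  have c2 : star (c ** star c) = c ** star c by rewrite !starE.
  have := psd_mul_starD d; rewrite d1 d2 => psum.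
  have e0 : p ** p ** (p ** p) = 0.
    apply: (psdD_eq0 (psd_sqr p2) (psdD (psd_sqr c2) psum)); module.
  have e1 : p ** p = 0 by apply: star_mul_eq0; rewrite p2.
  by apply: star_mul_eq0; rewrite pp.
have un : u ** n = 0 by rewrite -r2 -mulA -nr -/p p0 mulx0.
have n0 : n = 0.
  apply: star_mul_eq0; rewrite nn.
  have -> : n ** n = u ** n - x ** n by rewrite {1}/n mulDl mulNl.
  by rewrite xn un !oppr0 addr0.
have -> : x = u by apply/esym/eqP; rewrite -subr_eq0 -/n n0.
by rewrite u2; exact: uc.
Qed.

Lemma add_self_eq0 (x : A) : x + x = 0 -> x = 0.
Proof.
have e : 2^-1 * 2%:R = 1 :> R by field.
move=> h; rewrite -[x]scaleR1 -{1}e -scaleRA (_ : 2%:R%:C *: x = x + x).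
  by rewrite h scaler0.
module.
Qed.

(** Anticommuting with s implies commuting with s^2, hence with s, and then 2 a s = 0. *)
Lemma positive_anticommute a s : positive mul star s -> a ** s + s ** a = 0 ->
  a ** s = 0 /\ s ** a = 0.
Proof.
move=> ps h.
have as_ : a ** s = - (s ** a) by apply/eqP; rewrite -addr_eq0 h.
have sa : a ** s = s ** a.
  apply: commute_of_commute_sqr => //.
  by rewrite mulA as_ mulNl -!mulA as_ mulNr opprK.
by rewrite -sa; split; apply: add_self_eq0; rewrite {2}sa.
Qed.

(** * Annihilators as two-sided annihilators *)

Definition perp (S : A -> Prop) : A -> Prop :=
  fun a => forall s, S s -> a ** s = 0 /\ s ** a = 0.

Definition star_closed (S : A -> Prop) : Prop := forall s, S s -> S (star s).

Definition all_positive (S : A -> Prop) : Prop :=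
  forall s, S s -> positive mul star s.

Lemma positive_sa s : positive mul star s -> star s = s.
Proof. by move=> [b ->]; rewrite !starE. Qed.

Lemma positive_mul_star c : positive mul star (c ** star c).
Proof. by exists (star c); rewrite starK. Qed.

Lemma star_closed_positive S : all_positive S -> star_closed S.
Proof. by move=> pS s Ss; rewrite positive_sa //; exact: pS. Qed.

Lemma perp_star_closed S : star_closed S -> star_closed (perp S).
Proof.
move=> cS a ha s /cS /ha[h1 h2].
by split; rewrite -[s]starK -starM ?h1 ?h2 star0.
Qed.

Lemma perp_anti (S T : A -> Prop) : (forall s, S s -> T s) ->
  forall a, perp T a -> perp S a.
Proof. by move=> ST a h s /ST; exact: h. Qed.

Lemma sub_perp_perp S a : S a -> perp (perp S) a.
Proof. by move=> Sa s /(_ a Sa)[h1 h2]; split. Qed.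

Lemma perp0 S : perp S 0.
Proof. by move=> s _; rewrite mul0x mulx0. Qed.

Lemma perpD S x y : perp S x -> perp S y -> perp S (x + y).
Proof.
by move=> hx hy s Ss; have [? ?] := hx s Ss; have [? ?] := hy s Ss;
   split; rewrite !mulE (_ : mul _ _ = 0) // (_ : mul _ _ = 0) // addr0.
Qed.

Lemma perpZ S a x : perp S x -> perp S (a *: x).
Proof. by move=> hx s /hx[h1 h2]; rewrite !mulE h1 h2 scaler0. Qed.

Lemma perpB S x y : perp S x -> perp S y -> perp S (x - y).
Proof. by move=> hx hy; apply: perpD => //; rewrite -scaleN1r; exact: perpZ. Qed.

Lemma perp_sandwich S x b y : perp S x -> perp S y -> perp S (x ** b ** y).
Proof.
move=> hx hy s Ss; have [_ h1] := hx s Ss; have [h2 _] := hy s Ss.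
by rewrite -[x ** b ** y ** s]mulA h2 mulx0 -[x ** b ** y]mulA mulA h1 mul0x.
Qed.

Lemma perp_mul S x y : perp S x -> perp S y -> perp S (x ** y).
Proof.
move=> hx hy s Ss; have [_ h1] := hx s Ss; have [h2 _] := hy s Ss.
by rewrite -mulA h2 mulx0 mulA h1 mul0x.
Qed.

Lemma mul_starl_eq0 c a : star c ** c ** a = 0 -> c ** a = 0.
Proof.
by move=> h; apply: star_mul_eq0; rewrite starM -mulA (mulA _ c) h mulx0.
Qed.

Lemma mul_starr_eq0 c a : a ** (c ** star c) = 0 -> a ** c = 0.
Proof.
by move=> h; apply: mul_star_eq0; rewrite starM -mulA (mulA c) mulA h mul0x.
Qed.

Lemma sqr_sa_eq0 k : star k = k -> k ** k = 0 -> k = 0.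
Proof. by move=> kk h; apply: star_mul_eq0; rewrite kk. Qed.

(** Killing c c^* on the left kills c, and likewise for c^* c on the right, so the positive elements
    of B suffice. *)
Lemma perp_of_positive B a :
  (forall c, B c -> B (star c ** c) /\ B (c ** star c)) ->
  perp (fun s => B s /\ positive mul star s) a -> perp B a.
Proof.
move=> hB h c Bc; have [B1 B2] := hB c Bc; split.
  by apply: mul_starr_eq0; case: (h _ (conj B2 (positive_mul_star c))).
apply: mul_starl_eq0.
by have [|_] := h (star c ** c); first by split=> //; exists c.
Qed.

Lemma AnnE S : all_positive S -> Ann mul S = perp S.
Proof.
move=> pS; apply/funext => a; apply/propext; split=> h s Ss.
  by apply: positive_anticommute; [exact: pS | exact: h].
by have [-> ->] := h s Ss; rewrite addr0.
Qed.

Lemma perp_star_mul S c : star_closed S -> perp S c ->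
  perp S (star c ** c) /\ perp S (c ** star c).
Proof. by move=> cS h; have h' := perp_star_closed cS h; split; exact: perp_mul. Qed.

(** The inner annihilator need not consist of positive elements, so [AnnE] does not apply to it
    directly; testing on its positive part is enough. *)
Lemma Ann_AnnE S : all_positive S -> Ann mul (Ann mul S) = perp (perp S).
Proof.
move=> pS; have cS := star_closed_positive pS; rewrite (AnnE pS).
apply/funext => a; apply/propext; split=> h.
  apply: perp_of_positive => [c|s [Ss ps]]; first exact: perp_star_mul.
  by apply: positive_anticommute => //; exact: h.
by move=> s /h[-> ->]; rewrite addr0.
Qed.

(** The positive part of T' serves as the generating set, and T''' = T'. *)
Lemma annihilator_perp T : star_closed T -> annihilator mul star (perp T).
Proof.
move=> cT; pose S s := perp T s /\ positive mul star s.
have pS : all_positive S by move=> s [].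
exists S; split=> // a; rewrite Ann_AnnE //.
have <- : perp (perp T) = perp S.
  apply/funext => c; apply/propext; split; first by apply: perp_anti => s [].
  by apply: perp_of_positive => d; exact: perp_star_mul.
split; first exact: sub_perp_perp.
by apply: perp_anti => s; exact: sub_perp_perp.
Qed.

Lemma annihilatorP V : annihilator mul star V ->
  exists2 S, all_positive S & V = perp (perp S).
Proof.
move=> [S [pS VE]]; exists S => //; rewrite -Ann_AnnE //.
by apply/funext => a; apply/propext.
Qed.

Lemma perp_empty : perp (fun=> False) = fun=> True.
Proof. by apply/funext => a; apply/propext; split. Qed.

Lemma annihilator_full : annihilator mul star (fun=> True).
Proof. by rewrite -perp_empty; apply: annihilator_perp. Qed.

Lemma not_perpP S a : ~ perp S a -> exists2 w, S w & w <> 0.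
Proof.
move=> h; apply: contrapT => no; apply: h => s Ss.
have -> : s = 0 by apply: contrapT => s0; apply: no; exists s.
by rewrite mul0x mulx0.
Qed.

(** The diagonal case gives x a x = 0, so x a y is antisymmetric and x^2 a y = - (x y) a x = x a x y
    = 0. Taking x^* x for x, the C*-identity cancels the extra factors. *)
Lemma dperp_sandwich_eq0 V a : star_closed V ->
  (forall x y, V x -> V y -> V (x ** y)) -> dperp mul V a ->
  forall x y, V x -> V y -> x ** a ** y = 0.
Proof.
move=> cV mV h.
have sq x : V x -> x ** a ** x = 0 by move=> Vx; apply: add_self_eq0; exact: h.
have anti x y : V x -> V y -> x ** a ** y = - (y ** a ** x).
  by move=> Vx Vy; apply/eqP; rewrite -addr_eq0 h.
have sq2 x y : V x -> V y -> x ** x ** a ** y = 0.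
  move=> Vx Vy; rewrite -!mulA (mulA x a y) anti // !mulNr !mulA.
  rewrite (_ : x ** y ** a ** x = - (x ** a ** (x ** y))) ?opprK.
    by rewrite mulA sq // mul0x.
  by rewrite anti //; exact: mV.
move=> x y Vx Vy.
have Vh : V (star x ** x) by apply: mV => //; exact: cV.
have hh : star (star x ** x) = star x ** x by rewrite !starE.
rewrite -mulA; apply: mul_starl_eq0; apply: mul_starl_eq0.
by rewrite hh mulA sq2.
Qed.

(** * Central annihilators and ideals in a C*-factor *)

Section Factor.
Hypothesis Hfactor : cstar_factor mul.

(** Every product v b w with v in C = S'' and w in D = S' lies in both [dperp] sets, so centrality
    makes it vanish. Hence C and D are ideals with C D = 0, and D is nonzero if C is proper. *)
Lemma central_full C x : central mul star C -> C x -> x <> 0 -> forall a, C a.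
Proof.
move=> [S [pS [CE triv]]] Cx x0.
have cS := star_closed_positive pS.
have {}CE : C = perp (perp S).
  by rewrite -Ann_AnnE //; apply/funext => a; apply/propext.
move: triv; rewrite Ann_AnnE // AnnE // -CE => triv.
have cD : star_closed (perp S) := perp_star_closed cS.
have cC : star_closed C by rewrite CE; exact: perp_star_closed.
have CD v w : C v -> perp S w -> v ** w = 0 /\ w ** v = 0.
  by rewrite CE => Cv Dw; exact: Cv.
have cross v b w : C v -> perp S w -> v ** b ** w = 0.
  move=> Cv Dw; apply: triv => c d Hc Hd.
    by rewrite -!mulA (CD d w Hd Dw).2 (CD c w Hc Dw).2 !mulx0 addr0.
  rewrite -!mulA (mulA c v) (mulA d v).
  by rewrite (CD v c Cv Hc).2 (CD v d Cv Hd).2 !mul0x addr0.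
have cross' w b v : C v -> perp S w -> w ** b ** v = 0.
  move=> Cv Dw; have -> : w ** b ** v = star (star v ** star b ** star w).
    by rewrite !starE mulA.
  by rewrite cross ?star0 //; [exact: cC | exact: cD].
move=> a; apply: contrapT => nCa; apply: Hfactor; exists C, (perp S).
have [w Dw w0] : exists2 w, perp S w & w <> 0
  by apply: (@not_perpP _ a); rewrite -CE.
split; [|split; [|split; [|split; [|split; [|split]]]]].
- split; first by rewrite CE; exact: perp0.
  split; first by rewrite CE => *; exact: perpD.
  split; first by rewrite CE => *; exact: perpZ.
  move=> v b Cv; split; rewrite CE => s Ds.
    by rewrite -mulA (CD v s Cv Ds).1 mulx0 mulA cross'.
  by rewrite cross // mulA (CD v s Cv Ds).2 mul0x.
- split; first exact: perp0.
  split; first by move=> *; exact: perpD.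
  split; first by move=> *; exact: perpZ.
  move=> v b Dv; split=> s Ss; have Cs : C s by rewrite CE; exact: sub_perp_perp.
    by rewrite -mulA (CD s v Cs Dv).2 mulx0 mulA cross.
  by rewrite cross' // mulA (CD s v Cs Dv).1 mul0x.
- by exists x.
- by exists w.
- by exists a.
- exists x => Dx; apply: x0; apply: star_mul_eq0.
  by apply: (CD _ _ (cC _ Cx) Dx).1.
- by move=> c d Cc Dd; exact: (CD c d Cc Dd).1.
Qed.

(** The empty set generates it. Its centrality is what forces an annihilator with full central
    support to be nonzero when A is. *)
Lemma central_zero : central mul star (fun a => a = 0).
Proof.
have pS : all_positive (fun=> False) by [].
exists (fun=> False); split=> //; split.
  move=> a; rewrite Ann_AnnE // perp_empty; split=> [->|h]; first exact: perp0.
  by apply: star_mul_eq0; case: (h (star a)).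
rewrite Ann_AnnE // AnnE // perp_empty => a _ h.
apply: star_mul_eq0; apply: sqr_sa_eq0; first by rewrite !starE.
by rewrite mulA (@dperp_sandwich_eq0 (fun=> True) a) // mul0x.
Qed.

Lemma full_central_support_of_neq0 V (x : A) : V x -> x <> 0 ->
  full_central_support mul star V.
Proof.
move=> Vx x0; split; first exact: annihilator_full; split=> // C cC VC a _.
by apply: (central_full cC (VC x Vx) x0).
Qed.

Lemma full_central_support_neq0 V (w : A) : full_central_support mul star V ->
  w <> 0 -> exists2 v, V v & v <> 0.
Proof.
move=> [_ [h _]] w0; apply: contrapT => no; apply: w0.
apply: (h _ central_zero) => // v Vv.
by apply: contrapT => v0; apply: no; exists v.
Qed.

(** Otherwise W A V = 0. Then I, killing V and A V from the left, and J, killed by I and I A, are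
    ideals containing W and V with I J = 0; v^* and w^* show that they are proper. *)
Lemma factor_bridge (V W : A -> Prop) (v w : A) : star_closed W ->
  V v -> v <> 0 -> W w -> w <> 0 ->
  exists w' b v', [/\ W w', V v' & w' ** b ** v' <> 0].
Proof.
move=> cW Vv v0 Ww w0; apply: contrapT => no.
have WAV w' b v' : W w' -> V v' -> w' ** b ** v' = 0.
  by move=> Ww' Vv'; apply: contrapT => nz; apply: no; exists w', b, v'.
have WV w' v' : W w' -> V v' -> w' ** v' = 0.
  by move=> Ww' Vv'; apply: mul_starl_eq0; apply: WAV => //; exact: cW.
pose I x := forall v', V v' -> x ** v' = 0 /\ forall b, x ** b ** v' = 0.
pose J y := forall x, I x -> x ** y = 0 /\ forall b, x ** b ** y = 0.
have IW w' : W w' -> I w' by move=> Ww' v' Vv'; split=> [|b]; [exact: WV|exact: WAV].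
have JV v' : V v' -> J v' by move=> Vv' x /(_ v' Vv').
apply: Hfactor; exists I, J.
split; [|split; [|split; [|split; [|split; [|split]]]]].
- split; first by move=> v' _; split=> [|b]; rewrite !mul0x.
  split.
    move=> x y hx hy v' Vv'; have [x1 x2] := hx v' Vv'; have [y1 y2] := hy v' Vv'.
    by split=> [|b]; rewrite !mulDl ?x1 ?y1 ?x2 ?y2 addr0.
  split.
    move=> c x hx v' Vv'; have [x1 x2] := hx v' Vv'.
    by split=> [|b]; rewrite !mulZl ?x1 ?x2 scaler0.
  move=> x y hx; split=> v' Vv'; have [x1 x2] := hx v' Vv'.
    split=> [|b]; first by rewrite -mulA x1 mulx0.
    by rewrite -!mulA (mulA x) x2 mulx0.
  by split=> [|b]; rewrite ?x2 // -(mulA x) x2.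
- split; first by move=> x _; split=> [|b]; rewrite !mulx0.
  split.
    move=> x y hx hy z Iz; have [x1 x2] := hx z Iz; have [y1 y2] := hy z Iz.
    by split=> [|b]; rewrite !mulDr ?x1 ?y1 ?x2 ?y2 addr0.
  split.
    move=> c x hx z Iz; have [x1 x2] := hx z Iz.
    by split=> [|b]; rewrite !mulZr ?x1 ?x2 scaler0.
  move=> x y hx; split=> z Iz; have [x1 x2] := hx z Iz.
    by split=> [|b]; rewrite mulA ?x2 // -(mulA z) x2.
  by split=> [|b]; rewrite mulA ?x1 ?x2 mul0x.
- by exists w; split=> //; exact: IW.
- by exists v; split=> //; exact: JV.
- by exists (star v) => /(_ v Vv)[h _]; apply: v0; exact: star_mul_eq0.
- by exists (star w) => /(_ w (IW w Ww))[h _]; apply: w0; exact: mul_star_eq0.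
- by move=> a b Ia /(_ a Ia)[].
Qed.
End Factor.

(** * Annihilators generated by one self-adjoint element *)

Lemma sa_star_closed h : star h = h -> star_closed (fun s => s = h).
Proof. by move=> hh s ->. Qed.

Section Singleton.
Variable h : A.
Hypothesis hsa : star h = h.
Local Notation U := (perp (perp (fun s => s = h))).

Let scP : star_closed (perp (fun s => s = h)).
Proof. by apply: perp_star_closed; exact: sa_star_closed. Qed.

Let scU : star_closed U.
Proof. exact: perp_star_closed. Qed.

(** Such a k lies in {h}' as well as in {h}'', so k^2 = 0. *)
Let perp_sqr_eq0 k : star k = k -> h ** k = 0 -> U k -> k = 0.
Proof.
move=> kk hk Uk; apply: sqr_sa_eq0 => //.
have Pk : perp (fun s => s = h) k.
  by move=> s ->; split=> //; rewrite -[LHS]starK starM kk hsa hk star0.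
by have [] := Uk k Pk.
Qed.

Lemma perp_perp_mulr_eq0 k : U k -> k ** h = 0 -> k = 0.
Proof.
move=> Uk kh; apply: star_mul_eq0; apply: perp_sqr_eq0; first by rewrite !starE.
  by rewrite mulA -{1}hsa -starM kh star0 mul0x.
exact: (perp_star_mul scP Uk).1.
Qed.

Lemma perp_perp_sandwich_eq0 k : U k -> h ** k ** h = 0 -> k = 0.
Proof.
move=> Uk hkh; apply: perp_perp_mulr_eq0 => //; apply: mul_star_eq0.
apply: perp_sqr_eq0; first by rewrite !starE.
  by rewrite mulA mulA hkh mul0x.
rewrite starM hsa mulA -(mulA k); apply: perp_sandwich => //; exact: scU.
Qed.
End Singleton.

(* The map u |-> x^* u x compresses {x x^*}'' into the abelian V; cancelling
   h = x x^* turns commutation of the compressions into commutation in {h}''. *)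
Lemma abelian_perp_perp (V : A -> Prop) x : abelian mul V ->
  (forall u, V (star x ** u ** x)) ->
  abelian mul (perp (perp (fun s => s = x ** star x))).
Proof.
move=> abV Vx; set h := x ** star x.
have hsa : star h = h by rewrite /h !starE.
set U := perp _.
have Uh : U h by apply: sub_perp_perp.
have scU : star_closed U.
  by do 2!apply: perp_star_closed; exact: sa_star_closed.
have Umul u v : U u -> U v -> U (u ** v) by exact: perp_mul.
have P1 u v : U u -> U v -> u ** h ** v = v ** h ** u.
  move=> Uu Uv; apply/eqP; rewrite -subr_eq0; apply/eqP.
  apply: (perp_perp_sandwich_eq0 hsa).
    by apply: perpB; exact: perp_sandwich.
  have e a b : h ** (a ** h ** b) ** h =
      x ** (star x ** a ** x ** (star x ** b ** x)) ** star x.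
    by rewrite /h !mulA.
  by rewrite mulDr mulNr mulDl mulNl !e (abV _ _ (Vx u) (Vx v)) subrr.
(* For v in U, [P1] gives v k h = 0, so v k = 0 by cancelling h; then v = k^* yields k = 0. *)
clearbody h; have hU u : U u -> h ** u = u ** h.
  move=> Uu; apply/eqP; rewrite -subr_eq0; apply/eqP; set k := _ - _.
  have Uk : U k by apply: perpB; exact: Umul.
  suff vk v : U v -> v ** k = 0 by apply: star_mul_eq0; apply: vk; exact: scU.
  move=> Uv; rewrite /k mulDr mulNr !mulA P1 //.
  apply: (perp_perp_mulr_eq0 hsa).
    by apply: perpB; [exact: perp_sandwich | exact: Umul (Umul _ _ Uv Uu) Uh].
  have := P1 u (v ** h) Uu (Umul _ _ Uv Uh).
  rewrite mulA => e; rewrite mulDl mulNl e.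
  rewrite -!mulA (_ : h ** (h ** u) = u ** (h ** h)) ?subrr //.
  by rewrite !mulA -P1.
(* With h commuting with U, [P1] reads u v h = v u h, and h cancels. *)
move=> u v Uu Uv; apply/eqP; rewrite -subr_eq0; apply/eqP.
apply: (perp_perp_mulr_eq0 hsa); first by apply: perpB; exact: Umul.
by rewrite mulDl mulNl -!mulA -!hU // !mulA P1 // subrr.
Qed.

(** * Maximal orthogonal families of abelian annihilators *)

Section TypeI.
Hypothesis Hfactor : cstar_factor mul.
Hypothesis HI : vN_type_I mul star.

Let atom h := perp (perp (fun s => s = h)).

(** Generators h are collected instead of the annihilators {h}'', so that Zorn's lemma runs over
    subsets of A. *)
Definition atomic_family (E : set A) : Prop :=
  (forall h, E h -> [/\ h <> 0, positive mul star h & abelian mul (atom h)]) /\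
  (forall g h, E g -> E h -> g <> h -> g ** h = 0).

Lemma maximal_atomic_family : exists E, atomic_family E /\
  forall B, (E `<` B)%classic -> ~ atomic_family B.
Proof.
apply: Zorn_bigcup => F FP Ftot; split.
  by move=> h [E FE Eh]; have [+ _] := FP E FE; exact.
move=> g h [E FE Eg] [E' FE' Eh]; have [EE'|E'E] := Ftot _ _ FE FE'.
  by have [_ +] := FP E' FE'; apply => //; exact: EE'.
by have [_ +] := FP E FE; apply => //; exact: E'E.
Qed.

(** With x = w' b v' in W A V, where W = E', the element h = x x^* lies in W and x^* A x lies in V.
    It is new: h in E would give h^2 = 0. *)
Lemma atomic_family_extend E (w : A) : atomic_family E -> perp E w -> w <> 0 ->
  exists2 h, ~ E h & atomic_family (h |` E)%classic.
Proof.
move=> [E1 E2] Ww w0; have [V [aV [abV fV]]] := HI.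
have [v Vv v0] := full_central_support_neq0 fV w0.
have [S pS VE] := annihilatorP aV.
have pE : all_positive E by move=> h /E1[].
have scW : star_closed (perp E).
  by apply: perp_star_closed; exact: star_closed_positive.
have scV : star_closed V.
  by rewrite VE; do 2!apply: perp_star_closed; exact: star_closed_positive.
have [w' [b [v' [Ww' Vv' x0]]]] := factor_bridge Hfactor scW Vv v0 Ww w0.
move: x0; set x := w' ** b ** v' => x0; pose h := x ** star x.
have h0 : h <> 0 by move=> /mul_star_eq0.
have Wh : perp E h.
  have -> : h = w' ** (b ** v' ** star v' ** star b) ** star w'.
    by rewrite /h /x !starE !mulA.
  by apply: perp_sandwich => //; exact: scW.
have ph : positive mul star h by exact: positive_mul_star.
have ab : abelian mul (atom h).
  apply: (abelian_perp_perp abV) => u.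
  have -> : star x ** u ** x = star v' ** (star b ** star w' ** u ** w' ** b) ** v'.
    by rewrite /x !starE !mulA.
  by rewrite VE; apply: perp_sandwich; rewrite -VE //; exact: scV.
exists h.
  move=> Eh; apply: h0; apply: sqr_sa_eq0; first exact: positive_sa.
  by have [] := Wh h Eh.
split=> [g [->|/E1]//|g k [->|Eg] [->|Ek]] // gk; last exact: E2.
  by have [] := Wh k Ek.
by have [] := Wh g Eg.
Qed.

Lemma exists_type_I_n : exists Xi : Type, type_I_n mul star Xi.
Proof.
have [E [PE maxE]] := maximal_atomic_family; have [E1 E2] := PE.
(* The family is indexed by E itself, so n is the cardinality of E. *)
exists {h : A | E h}, (fun i => atom (sval i)).
have scP h : E h -> star_closed (fun s => s = h).
  by move=> /E1[_ ph _]; apply: sa_star_closed; exact: positive_sa.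
split=> [[h Eh] /=|].
  have [h0 ph ab] := E1 h Eh; split.
    by apply: annihilator_perp; apply: perp_star_closed; exact: scP.
  split=> //; apply: (full_central_support_of_neq0 Hfactor (x := h)) => //.
  exact: sub_perp_perp.
split=> [[g Eg] [h Eh] gh /= a c Ga Hc|].
  have {}gh : g <> h
    by move=> e; subst h; apply: gh; congr exist; exact: Prop_irrelevance.
  have Pg : perp (fun s => s = h) a; last by have [] := Hc a Pg.
  move=> s ->; apply: Ga => _ ->.
  by split; apply: E2 => //; apply: nesym.
split; first exact: annihilator_full; split=> // U aU FU a _.
have [S pS UE] := annihilatorP aU; rewrite UE.
(* An a outside U = S'' forces a nonzero w in S; since E lies in U, w annihilates E and E could be
   enlarged. *)
apply: contrapT => /not_perpP[w Sw w0].
have Ew : perp E w.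
  move=> h Eh; have Uh : U h by apply: (FU (exist _ h Eh)); exact: sub_perp_perp.
  by move: Uh; rewrite UE => /(_ w Sw)[].
have [h nEh] := atomic_family_extend PE Ew w0; apply: maxE.
by split=> [|/(_ h (or_introl erefl))//] g; right.
Qed.
End TypeI.
End CStarAlgebra.

Theorem theorem25 (R : realType) (A : lmodType R[i])
    (mul : A -> A -> A) (star : A -> A) (nrm : A -> R)
    (HA : is_cstar_algebra mul star nrm)
    (Hfactor : cstar_factor mul)
    (HI : vN_type_I mul star) :
  exists Xi : Type, type_I_n mul star Xi.
Proof. exact: (exists_type_I_n HA Hfactor HI). Qed.
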